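(* Let $\alpha,\beta\in\mathbb{R}$ with $|\alpha|\neq|\beta|$. Let $p,q\in\mathbb{N}$ be such that $2\le q\le 2p$, and let $$\mathcal{I}_{p,q}(\alpha,\beta)=\int_0^\infty\frac{(\cos\alpha x-\cos\beta x)^p}{x^q}\,dx.$$ (a) If $q$ is even, then $$\mathcal{I}_{p,q}(\alpha,\beta)=\frac{\pi(-1)^{\frac q2}}{2(q-1)!}\sum_{n=1}^N\Lambda_{r_n}|\chi_{r_n}(1)|^{q-1}.$$ (b) If $q$ is odd, then $$\mathcal{I}_{p,q}(\alpha,\beta)=\frac{(-1)^{\frac{q-1}2}}{(q-1)!}\sum_{n=1}^{N-1}\Xi_n\log\left|\frac{\chi_{r_{n+1}}(1)}{\chi_{r_n}(1)}\right|.$$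
   Context: $\mathbb{N}=\{1,2,3,\ldots\}$. The integral is an improper (Riemann) integral at both endpoints ($\lim$ of $\int_\varepsilon^R$ as $\varepsilon\to0^+$, $R\to\infty$). Fix $\alpha,\beta,p,q$. Let $$\Omega_1:=\{(k,\ell,m)\in(\mathbb{N}\cup\{0\})^3 : 0\le k\le p-1,\ 0\le\ell\le p-k-1,\ 0\le m\le k\},$$ $$\Omega_2:=\{(p,\ell,0) : \ell\in\mathbb{N}\cup\{0\},\ 0\le\ell\le p-1\},\qquad \Omega:=\Omega_1\cup\Omega_2.$$ For $(k,\ell,m)\in\Omega$ put $$\Lambda_{k,\ell,m}:=\begin{cases}\dfrac{(-1)^k}{2^{p-1}}\dbinom pk\dbinom{p-k-1}{\ell}\dbinom km & \text{if }k\in\{0,1,\ldots,p-1\},\\[2mm] \dfrac{(-1)^p}{2^{p-1}}\dbinom{p-1}{\ell} & \text{if }k=p,\end{cases}$$ $$\chi_{k,\ell,m}(x):=\begin{cases}(p-k-2\ell)\alpha x+(k-2m)\beta x & \text{if }k\in\{0,1,\ldots,p-1\},\\ (p-2\ell)\beta x & \text{if }k=p.\end{cases}$$ Let $\tilde\Omega:=\{(k,\ell,m)\in\Omega : \chi_{k,\ell,m}(1)\neq0\}$, and let $r_1,r_2,\ldots,r_N$ be an enumeration (in any order, without repetition) of the elements of $\tilde\Omega$, so $N=|\tilde\Omega|$. For $1\le n\le N$ put $$\Xi_n:=\sum_{j=1}^n\Lambda_{r_j}\,(\chi_{r_j}(1))^{q-1}.$$ *)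

(* Defs.v *)
From Stdlib Require Import Arith Factorial Reals.
From Coquelicot Require Import Coquelicot.
Open Scope R_scope.

Definition Omega1 (p : nat) (t : nat * nat * nat) : Prop :=
  let '(k, l, m) := t in
  (k <= p - 1 /\ l <= p - k - 1 /\ m <= k)%nat.

Definition Omega2 (p : nat) (t : nat * nat * nat) : Prop :=
  let '(k, l, m) := t in
  (k = p /\ l <= p - 1 /\ m = 0)%nat.

Definition Omega (p : nat) (t : nat * nat * nat) : Prop :=
  Omega1 p t \/ Omega2 p t.

(* [Binomial.C] is the real-valued binomial coefficient; the unqualified [C] is
   Coquelicot's type of complex numbers. *)
Definition Lambda (p : nat) (t : nat * nat * nat) : R :=
  let '(k, l, m) := t in
  if (k <? p)%nat then
    (-1) ^ k / 2 ^ (p - 1)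
      * Binomial.C p k * Binomial.C (p - k - 1) l * Binomial.C k m
  else
    (-1) ^ p / 2 ^ (p - 1) * Binomial.C (p - 1) l.

Definition chi (alpha beta : R) (p : nat) (t : nat * nat * nat) (x : R) : R :=
  let '(k, l, m) := t in
  if (k <? p)%nat then
    (INR p - INR k - 2 * INR l) * alpha * x + (INR k - 2 * INR m) * beta * x
  else
    (INR p - 2 * INR l) * beta * x.

Definition Omega_tilde (alpha beta : R) (p : nat) (t : nat * nat * nat) : Prop :=
  Omega p t /\ chi alpha beta p t 1 <> 0.

(* [r 1, ..., r N] lists the elements of [A] without repetition, so that
   [N] is the cardinality of [A]; values of [r] outside 1..N are irrelevant. *)
Definition is_enumeration {T : Type} (A : T -> Prop) (N : nat) (r : nat -> T) : Prop :=
  (forall n, (1 <= n <= N)%nat -> A (r n)) /\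
  (forall i j, (1 <= i <= N)%nat -> (1 <= j <= N)%nat -> r i = r j -> i = j) /\
  (forall t, A t -> exists n, (1 <= n <= N)%nat /\ r n = t).

(* [sum_n_m f a b] is 0 when b < a. *)
Definition Xi (alpha beta : R) (p q : nat) (r : nat -> nat * nat * nat) (n : nat) : R :=
  sum_n_m (fun j => Lambda p (r j) * chi alpha beta p (r j) 1 ^ (q - 1)) 1 n.

(* The improper integral converges at both endpoints and has value [v]. *)
Definition is_I (p q : nat) (alpha beta v : R) : Prop :=
  is_RInt_gen (fun x => (cos (alpha * x) - cos (beta * x)) ^ p / x ^ q)
    (at_right 0) (Rbar_locally p_infty) v.

(* Main.v *)
Require Import Defs.
From Stdlib Require Import Arith Factorial Reals List Permutation Lra Lia.
From Coquelicot Require Import Coquelicot.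
Open Scope R_scope.

(** Put [F x = (cos (alpha x) - cos (beta x)) ^ p].  Expanding each power of a
    cosine into a sum of cosines gives [F x = sum Lambda_t cos (chi_t x)] over
    the index set ([cos_difference_power]), so every derivative of [F] is an
    explicit trigonometric sum, bounded on the whole line ([trig_sum]).

    Since [cos (alpha x) - cos (beta x)] is [O(x^2)], [F] is [O(x^(2p))] at the
    origin, hence its derivatives of order below [2p] vanish there
    ([derivative_family_vanish]).  As [q <= 2p], integrating by parts [q-1]
    times produces no boundary term at either end and leaves
    [1 / (q-1)!] times the integral of [F^(q-1)(x) / x]
    ([improper_value_reduce]).

    If [q] is even, [F^(q-1)] is a sum of sines and each term is a Dirichlet
    integral, worth [sign(a) PI / 2] for [sin (a x) / x].  If [q] is odd,
    [F^(q-1)] is a sum of cosines whose coefficients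
    [w_t = Lambda_t chi_t^(q-1)] add up to [0], up to sign, because
    [F^(q-1)(0) = 0].  So [cos x] may be subtracted from every [cos (chi_t x)],
    and each term becomes the Frullani integral of [(cos (a x) - cos x) / x],
    worth [- ln |a|].  The result is [- sum w_t ln |chi_t|], and the form with
    the partial sums [Xi_n] follows by Abel summation, where the sum of all the
    weights is again [0] ([abel_summation]).

    Convergence is handled throughout by exhibiting a primitive on [(0, +oo)]
    with finite limits at both ends ([improper_value]). *)

(** * Finite sums over lists *)

Definition lsum {T : Type} (f : T -> R) (L : list T) : R :=
  fold_right (fun t s => f t + s) 0 L.

Lemma lsum_cons {T : Type} (f : T -> R) (t : T) (L : list T) :
  lsum f (t :: L) = f t + lsum f L.
Proof. reflexivity. Qed.

Lemma lsum_app {T : Type} (f : T -> R) (L L' : list T) :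
  lsum f (L ++ L') = lsum f L + lsum f L'.
Proof. induction L as [|t L IH]; simpl; [ring | rewrite IH; ring]. Qed.

Lemma lsum_ext {T : Type} (f g : T -> R) (L : list T) :
  (forall t, In t L -> f t = g t) -> lsum f L = lsum g L.
Proof.
  induction L as [|t L IH]; simpl; intros H; [reflexivity|].
  rewrite H by auto. rewrite IH by auto. reflexivity.
Qed.

Lemma lsum_scal {T : Type} (c : R) (f : T -> R) (L : list T) :
  lsum (fun t => c * f t) L = c * lsum f L.
Proof. induction L as [|t L IH]; simpl; [ring | rewrite IH; ring]. Qed.

Lemma lsum_map {S T : Type} (g : S -> T) (f : T -> R) (L : list S) :
  lsum f (map g L) = lsum (fun s => f (g s)) L.
Proof. induction L as [|t L IH]; simpl; [ring | rewrite IH; ring]. Qed.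

Lemma lsum_flat_map {S T : Type} (g : S -> list T) (f : T -> R) (L : list S) :
  lsum f (flat_map g L) = lsum (fun s => lsum f (g s)) L.
Proof.
  induction L as [|t L IH]; simpl; [ring | rewrite lsum_app, IH; ring].
Qed.

Lemma lsum_permutation {T : Type} (f : T -> R) (L L' : list T) :
  Permutation L L' -> lsum f L = lsum f L'.
Proof. induction 1; simpl; lra. Qed.

Lemma lsum_filter {T : Type} (b : T -> bool) (f : T -> R) (L : list T) :
  (forall t, b t = false -> f t = 0) -> lsum f (filter b L) = lsum f L.
Proof.
  intros H; induction L as [|t L IH]; simpl; [reflexivity|].
  destruct (b t) eqn:E; simpl; rewrite IH; [reflexivity|].
  rewrite (H t E); ring.
Qed.

Lemma lsum_seq0 (f : nat -> R) (n : nat) :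
  lsum f (seq 0 (S n)) = sum_f_R0 f n.
Proof.
  induction n as [|n IH]; [simpl; ring|].
  rewrite seq_S, lsum_app, IH; simpl; ring.
Qed.

Lemma lsum_seq1 (f : nat -> R) (n : nat) :
  lsum f (seq 1 n) = sum_n_m f 1 n.
Proof.
  induction n as [|n IH].
  - rewrite sum_n_m_zero by lia. reflexivity.
  - rewrite seq_S, lsum_app, IH, sum_n_Sm by lia.
    unfold plus; simpl; ring.
Qed.

Lemma lsum_abs_le {T : Type} (f g : T -> R) (L : list T) :
  (forall t, Rabs (f t) <= g t) -> Rabs (lsum f L) <= lsum g L.
Proof.
  intros H; induction L as [|t L IH]; simpl; [rewrite Rabs_R0; lra|].
  eapply Rle_trans; [apply Rabs_triang|]. specialize (H t). lra.
Qed.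

(** The key [g] recovers which block an element comes from, so distinct
    blocks cannot share an element. *)
Lemma NoDup_flat_map_key {S T : Type} (f : S -> list T) (g : T -> S)
    (L : list S) :
  NoDup L -> (forall s, NoDup (f s)) ->
  (forall s t, In t (f s) -> g t = s) -> NoDup (flat_map f L).
Proof.
  intros HL Hf Hg; induction HL as [|s L Hs HL IH]; simpl; [constructor|].
  apply NoDup_app; auto.
  intros t Ht Ht'. apply in_flat_map in Ht'. destruct Ht' as [s' [Hs' Ht']].
  apply Hg in Ht; apply Hg in Ht'. subst. contradiction.
Qed.

(** * The index set and the product-to-sum formula *)

Definition Omega_list (p : nat) : list (nat * nat * nat) :=
  flat_map (fun k => flat_map (fun l => map (fun m => (k, l, m)) (seq 0 (S k)))
                              (seq 0 (p - k))) (seq 0 p)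
  ++ map (fun l => (p, l, 0%nat)) (seq 0 p).

Lemma in_Omega_list (p : nat) (t : nat * nat * nat) :
  (1 <= p)%nat -> In t (Omega_list p) <-> Omega p t.
Proof.
  intros hp; destruct t as [[k l] m]; unfold Omega_list, Omega, Omega1, Omega2.
  rewrite in_app_iff, in_map_iff, in_flat_map.
  split.
  - intros [[k' [Hk H]] | [l' [H Hl]]].
    + apply in_flat_map in H. destruct H as [l' [Hl H]].
      apply in_map_iff in H. destruct H as [m' [H Hm]].
      rewrite in_seq in *. injection H; intros; subst. left; lia.
    + rewrite in_seq in *. injection H; intros; subst. right; lia.
  - intros [H | H].
    + left. exists k. rewrite in_seq. split; [lia|].
      apply in_flat_map. exists l. rewrite in_seq. split; [lia|].
      apply in_map_iff. exists m. rewrite in_seq. split; [reflexivity | lia].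
    + right. exists l. rewrite in_seq. destruct H as [-> [H ->]].
      split; [reflexivity | lia].
Qed.

Lemma NoDup_Omega_list (p : nat) : NoDup (Omega_list p).
Proof.
  unfold Omega_list. apply NoDup_app.
  - apply NoDup_flat_map_key with (g := fun t => fst (fst t)).
    + apply seq_NoDup.
    + intros k. apply NoDup_flat_map_key with (g := fun t => snd (fst t)).
      * apply seq_NoDup.
      * intros l. apply FinFun.Injective_map_NoDup; [|apply seq_NoDup].
        intros m m' H; injection H; auto.
      * intros l t H. apply in_map_iff in H. destruct H as [m [<- _]]. reflexivity.
    + intros k t H. apply in_flat_map in H. destruct H as [l [_ H]].
      apply in_map_iff in H. destruct H as [m [<- _]]. reflexivity.
  - apply FinFun.Injective_map_NoDup; [|apply seq_NoDup].
    intros l l' H; injection H; auto.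
  - intros t H H'. apply in_map_iff in H'. destruct H' as [l [<- _]].
    apply in_flat_map in H. destruct H as [k [Hk H]].
    apply in_flat_map in H. destruct H as [l' [_ H]].
    apply in_map_iff in H. destruct H as [m [H _]].
    injection H; intros; subst. rewrite in_seq in Hk. lia.
Qed.

(** Terms of frequency zero may be dropped, so sums along the enumeration are
    sums over the whole index set. *)
Lemma lsum_enumeration (alpha beta : R) (p N : nat)
    (r : nat -> nat * nat * nat) (f : nat * nat * nat -> R) :
  (1 <= p)%nat ->
  is_enumeration (Omega_tilde alpha beta p) N r ->
  (forall t, chi alpha beta p t 1 = 0 -> f t = 0) ->
  sum_n_m (fun n => f (r n)) 1 N = lsum f (Omega_list p).
Proof.
  intros hp [Hin [Hinj Hsur]] Hf.
  set (b := fun t => if Req_EM_T (chi alpha beta p t 1) 0 then false else true).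
  rewrite <- (lsum_filter b).
  2:{ intros t; unfold b; destruct Req_EM_T; [auto | discriminate]. }
  rewrite <- (lsum_seq1 (fun n => f (r n))), <- (lsum_map r f).
  apply lsum_permutation, NoDup_Permutation.
  - apply NoDup_map_NoDup_ForallPairs; [|apply seq_NoDup].
    intros i j Hi Hj. rewrite in_seq in *. apply Hinj; lia.
  - apply NoDup_filter, NoDup_Omega_list.
  - intros t. rewrite in_map_iff, filter_In, (in_Omega_list p t hp). split.
    + intros [n [<- Hn]]. rewrite in_seq in Hn.
      destruct (Hin n ltac:(lia)) as [H1 H2]. split; [exact H1|].
      unfold b; destruct Req_EM_T; [contradiction | reflexivity].
    + intros [H1 H2]. destruct (Hsur t) as [n [Hn <-]].
      { split; [exact H1|]. unfold b in H2. destruct Req_EM_T; [discriminate | assumption]. }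
      exists n. rewrite in_seq. split; [reflexivity | lia].
Qed.

(** Pascal's rule in summed form: a binomial sum of order [n+1] is one of
    order [n] applied to [f l + f (l+1)]. Boundary terms are treated apart
    because [Binomial.C n (S n)] is not [0]. *)
Lemma sum_pascal (f : nat -> R) (n : nat) :
  sum_f_R0 (fun l => Binomial.C (S n) l * f l) (S n)
  = sum_f_R0 (fun l => Binomial.C n l * (f l + f (S l))) n.
Proof.
  assert (C0 : forall k, Binomial.C k 0 = 1).
  { intros k. unfold Binomial.C. rewrite Nat.sub_0_r. simpl fact. simpl INR.
    field. apply INR_fact_neq_0. }
  assert (Cn : forall k, Binomial.C k k = 1).
  { intros k. unfold Binomial.C. rewrite Nat.sub_diag. simpl fact. simpl INR.
    field. apply INR_fact_neq_0. }
  assert (E : forall k, (k <= n)%nat ->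
    sum_f_R0 (fun l => Binomial.C (S n) l * f l) k + Binomial.C n k * f (S k)
    = sum_f_R0 (fun l => Binomial.C n l * (f l + f (S l))) k).
  { induction k as [|k IH]; intros Hk.
    - simpl. rewrite !C0. ring.
    - rewrite !tech5, <- IH by lia. rewrite <- pascal by lia. ring. }
  rewrite tech5, <- E by lia. rewrite !Cn. reflexivity.
Qed.

(** The real part of [e^(i theta) (e^(i a) + e^(-i a))^n]. *)
Lemma sum_binomial_cos (n : nat) (theta a : R) :
  sum_f_R0 (fun l => Binomial.C n l * cos (theta + (INR n - 2 * INR l) * a)) n
  = (2 * cos a) ^ n * cos theta.
Proof.
  revert theta; induction n as [|n IH]; intros theta.
  - simpl. unfold Binomial.C; simpl. rewrite !Rmult_0_r, Rminus_0_r, Rmult_0_l, Rplus_0_r.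
    field.
  - rewrite (sum_pascal (fun l => cos (theta + (INR (S n) - 2 * INR l) * a))).
    transitivity (2 * cos a *
      sum_f_R0 (fun l => Binomial.C n l * cos (theta + (INR n - 2 * INR l) * a)) n).
    + rewrite scal_sum. apply sum_eq; intros l _. rewrite !S_INR.
      set (u := theta + (INR n - 2 * INR l) * a).
      replace (theta + (INR n + 1 - 2 * INR l) * a) with (u + a) by (unfold u; ring).
      replace (theta + (INR n + 1 - 2 * (INR l + 1)) * a) with (u - a) by (unfold u; ring).
      rewrite cos_plus, cos_minus. ring.
    + rewrite IH. simpl. ring.
Qed.

(** For each [k], the double sum over [l] and [m] is a real part
    of [e^(i u) (2 cos u)^(p-k-1) (2 cos v)^k] with [u = alpha x] and
    [v = beta x], which is [2^(p-1) (cos u)^(p-k) (cos v)^k]; summing over [k]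
    is then the binomial theorem. *)
Lemma cos_difference_power (alpha beta : R) (p : nat) (x : R) :
  (1 <= p)%nat ->
  lsum (fun t => Lambda p t * cos (chi alpha beta p t 1 * x)) (Omega_list p)
  = (cos (alpha * x) - cos (beta * x)) ^ p.
Proof.
  intros hp. unfold Omega_list. rewrite lsum_app, lsum_flat_map, lsum_map.
  set (u := alpha * x). set (v := beta * x).
  assert (P2 : 2 ^ (p - 1) <> 0) by (apply pow_nonzero; lra).
  replace (cos u - cos v) with (- cos v + cos u) by ring.
  rewrite binomial.
  destruct p as [|n]; [lia|]. replace (S n - 1)%nat with n in * by lia.
  rewrite tech5. f_equal.
  - rewrite <- lsum_seq0. apply lsum_ext. intros k Hk. apply in_seq in Hk.
    rewrite lsum_flat_map.
    replace (S n - k)%nat with (S (n - k)) by lia.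
    transitivity ((-1) ^ k / 2 ^ n * Binomial.C (S n) k * (2 * cos v) ^ k *
      ((2 * cos u) ^ (n - k) * cos u)).
    + rewrite <- sum_binomial_cos, <- lsum_seq0, <- lsum_scal.
      apply lsum_ext; intros l Hl. apply in_seq in Hl.
      rewrite lsum_map.
      transitivity ((-1) ^ k / 2 ^ n * Binomial.C (S n) k * Binomial.C (n - k) l *
        ((2 * cos v) ^ k * cos (u + (INR (n - k) - 2 * INR l) * u))); [|ring].
      rewrite <- sum_binomial_cos, <- lsum_seq0, <- lsum_scal.
      apply lsum_ext; intros m _. unfold Lambda, chi.
      destruct (Nat.ltb_spec k (S n)) as [_|]; [|lia].
      replace (S n - k - 1)%nat with (n - k)%nat by lia.
      replace (S n - 1)%nat with n by lia.
      rewrite S_INR, minus_INR by lia.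
      replace (((INR n + 1 - INR k - 2 * INR l) * alpha * 1 +
                (INR k - 2 * INR m) * beta * 1) * x)
        with (u + (INR n - INR k - 2 * INR l) * u + (INR k - 2 * INR m) * v)
        by (unfold u, v; ring).
      ring.
    + rewrite !Rpow_mult_distr. replace (- cos v) with (-1 * cos v) by ring.
      rewrite Rpow_mult_distr.
      replace (2 ^ n) with (2 ^ k * 2 ^ (n - k))
        by (rewrite <- pow_add; f_equal; lia).
      simpl (cos u ^ S (n - k)). field; split; apply pow_nonzero; lra.
  - transitivity ((-1) ^ S n / 2 ^ n * ((2 * cos v) ^ n * cos v)).
    + rewrite <- sum_binomial_cos, <- lsum_seq0, <- lsum_scal.
      apply lsum_ext; intros l _. unfold Lambda, chi. rewrite Nat.ltb_irrefl.
      replace (S n - 1)%nat with n by lia. rewrite S_INR.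
      replace ((INR n + 1 - 2 * INR l) * beta * 1 * x)
        with (v + (INR n - 2 * INR l) * v) by (unfold v; ring).
      ring.
    + rewrite Nat.sub_diag. unfold Binomial.C. rewrite Nat.sub_diag.
      replace (- cos v) with (-1 * cos v) by ring.
      rewrite !Rpow_mult_distr. simpl. field.
      split; [|exact P2]. 
      exact (INR_fact_neq_0 (S n)).
Qed.

(** * Improper integrals through a primitive *)

Lemma filterlim_Rplus {T : Type} (F : (T -> Prop) -> Prop) {FF : Filter F}
    (f g : T -> R) (a b : R) :
  filterlim f F (locally a) -> filterlim g F (locally b) ->
  filterlim (fun x => f x + g x) F (locally (a + b)).
Proof.
  intros Hf Hg. apply (filterlim_comp_2 f g Rplus Hf Hg).
  exact (filterlim_plus (V := R_NormedModule) a b).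
Qed.

Lemma filterlim_Rscal {T : Type} (F : (T -> Prop) -> Prop) (c : R) (f : T -> R) (a : R) :
  filterlim f F (locally a) -> filterlim (fun x => c * f x) F (locally (c * a)).
Proof.
  intros Hf. apply (filterlim_comp _ _ _ f (Rmult c) _ _ _ Hf).
  exact (filterlim_scal_r (V := R_NormedModule) c a).
Qed.

Lemma filterlim_at_right_0 (f : R -> R) (M l : R) :
  (forall x, 0 < x < 1 -> Rabs (f x - l) <= M * x) ->
  filterlim f (at_right 0) (locally l).
Proof.
  intros H. apply filterlim_locally. intros eps.
  assert (Hm : 0 < Rmax M 0 + 1) by (generalize (Rmax_r M 0); lra).
  assert (Hd : 0 < Rmin 1 (eps / (Rmax M 0 + 1))).
  { apply Rmin_pos; [lra|]. apply Rdiv_lt_0_compat; [apply cond_pos | exact Hm]. }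
  exists (mkposreal _ Hd). intros x Hx Hx0.
  change (Rabs (x - 0) < Rmin 1 (eps / (Rmax M 0 + 1))) in Hx.
  rewrite Rminus_0_r, Rabs_pos_eq in Hx by lra.
  assert (x < 1) by (generalize (Rmin_l 1 (eps / (Rmax M 0 + 1))); lra).
  assert (Hx2 : x < eps / (Rmax M 0 + 1))
    by (generalize (Rmin_r 1 (eps / (Rmax M 0 + 1))); lra).
  change (Rabs (f x - l) < eps).
  apply Rle_lt_trans with (M * x); [apply H; lra|].
  apply (Rmult_lt_compat_r (Rmax M 0 + 1)) in Hx2; [|exact Hm].
  unfold Rdiv in Hx2. rewrite Rmult_assoc, Rinv_l, Rmult_1_r in Hx2 by lra.
  generalize (Rmult_le_compat_r x _ _ (Rlt_le _ _ Hx0) (Rmax_l M 0)). lra.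
Qed.

Lemma filterlim_p_infty (f : R -> R) (M l : R) :
  (forall x, 1 < x -> Rabs (f x - l) <= M / x) ->
  filterlim f (Rbar_locally p_infty) (locally l).
Proof.
  intros H. apply filterlim_locally. intros eps.
  exists (Rmax 1 (M / eps)). intros x Hx.
  assert (H1 : 1 < x) by (generalize (Rmax_l 1 (M / eps)); lra).
  assert (H2 : M / eps < x) by (generalize (Rmax_r 1 (M / eps)); lra).
  change (Rabs (f x - l) < eps).
  apply Rle_lt_trans with (M / x); [apply H; lra|].
  assert (He := cond_pos eps).
  apply Rlt_div_l; [lra|]. apply Rlt_div_l in H2; [|lra]. lra.
Qed.

(** Stated through a primitive instead of an integral, so that linearity and
    integration by parts need no bookkeeping of integrability. *)
Definition improper_value (f : R -> R) (v : R) : Prop :=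
  exists (Phi : R -> R) (l0 l1 : R),
    (forall x, 0 < x -> is_derive Phi x (f x)) /\
    filterlim Phi (at_right 0) (locally l0) /\
    filterlim Phi (Rbar_locally p_infty) (locally l1) /\
    v = l1 - l0.

Lemma improper_value_is_RInt_gen (f : R -> R) (v : R) :
  improper_value f v -> (forall x, 0 < x -> continuous f x) ->
  is_RInt_gen f (at_right 0) (Rbar_locally p_infty) v.
Proof.
  intros [Phi [l0 [l1 [HD [H0 [H1 ->]]]]]] Hc.
  assert (Hpos : filter_prod (at_right 0) (Rbar_locally p_infty)
    (fun ab => forall x, Rmin (fst ab) (snd ab) <= x <= Rmax (fst ab) (snd ab)
                         -> 0 < x)).
  { apply Filter_prod with (Q := fun a => 0 < a) (R := fun b => 0 < b).
    - exists (mkposreal 1 Rlt_0_1). intros; assumption.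
    - exists 0. intros; assumption.
    - intros a b Ha Hb x [Hx _]. simpl in Hx.
      apply Rlt_le_trans with (2 := Hx). apply Rmin_pos; assumption. }
  intros P [eps HP].
  assert (Hlim : filterlim (fun ab : R * R => Phi (snd ab) + -1 * Phi (fst ab))
    (filter_prod (at_right 0) (Rbar_locally p_infty)) (locally (l1 + -1 * l0))).
  { apply filterlim_Rplus; [exact _ | |apply filterlim_Rscal].
    - apply filterlim_comp with (2 := H1). apply filterlim_snd.
    - apply filterlim_comp with (2 := H0). apply filterlim_fst. }
  replace (l1 + -1 * l0) with (l1 - l0) in Hlim by ring.
  specialize (Hlim _ (ex_intro _ eps HP)).
  unfold filtermapi, filtermap in *.
  generalize (filter_and _ _ Hpos Hlim). apply filter_imp.
  intros [a b] [Hx Hv]; simpl in *.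
  exists (Phi b + -1 * Phi a). split; [|exact Hv].
  replace (Phi b + -1 * Phi a) with (minus (Phi b) (Phi a))
    by (unfold minus, plus, opp; simpl; ring).
  apply (is_RInt_derive Phi f); intros x H; [apply HD | apply Hc]; auto.
Qed.

Lemma improper_value_ext (f g : R -> R) (v : R) :
  (forall x, 0 < x -> f x = g x) -> improper_value f v -> improper_value g v.
Proof.
  intros H [Phi [l0 [l1 [HD HL]]]]. exists Phi, l0, l1. split; [|exact HL].
  intros x Hx. rewrite <- H by exact Hx. auto.
Qed.

Lemma improper_value_0 : improper_value (fun _ => 0) 0.
Proof.
  exists (fun _ => 0), 0, 0.
  split; [|split; [|split]]; [|apply filterlim_const|apply filterlim_const|ring].
  intros x _. exact (is_derive_const 0 x).
Qed.

Lemma improper_value_plus (f g : R -> R) (u v : R) :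
  improper_value f u -> improper_value g v ->
  improper_value (fun x => f x + g x) (u + v).
Proof.
  intros [Phi [a0 [a1 [HD [H0 [H1 ->]]]]]] [Psi [b0 [b1 [KD [K0 [K1 ->]]]]]].
  exists (fun x => Phi x + Psi x), (a0 + b0), (a1 + b1).
  split; [|split; [|split]]; [| | |ring].
  - intros x Hx. apply (is_derive_plus Phi Psi); auto.
  - apply filterlim_Rplus; [exact _ | assumption..].
  - apply filterlim_Rplus; [exact _ | assumption..].
Qed.

Lemma improper_value_scal (c : R) (f : R -> R) (v : R) :
  improper_value f v -> improper_value (fun x => c * f x) (c * v).
Proof.
  intros [Phi [l0 [l1 [HD [H0 [H1 ->]]]]]].
  exists (fun x => c * Phi x), (c * l0), (c * l1).
  split; [|split; [|split]]; [|apply filterlim_Rscal; assumption|apply filterlim_Rscal; assumption|ring].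
  intros x Hx. apply (is_derive_scal Phi); auto.
Qed.

Lemma improper_value_lsum {T : Type} (f : T -> R -> R) (v : T -> R) (L : list T) :
  (forall t, improper_value (f t) (v t)) ->
  improper_value (fun x => lsum (fun t => f t x) L) (lsum v L).
Proof.
  intros H; induction L as [|t L IH]; simpl; [apply improper_value_0|].
  apply improper_value_plus; auto.
Qed.

(** Integration by parts: [(Phi - g x / x^s) / s] is a primitive of
    [g x / x^(s+1)] when [Phi] is one of [g' x / x^s]. The boundary term
    vanishes at both ends, so only the factor [1 / s] remains. *)
Lemma improper_value_by_parts (g g' : R -> R) (s : nat) (v : R) :
  (1 <= s)%nat ->
  (forall x, 0 < x -> is_derive g x (g' x)) ->
  filterlim (fun x => g x / x ^ s) (at_right 0) (locally 0) ->
  filterlim (fun x => g x / x ^ s) (Rbar_locally p_infty) (locally 0) ->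
  improper_value (fun x => g' x / x ^ s) v ->
  improper_value (fun x => g x / x ^ (S s)) (v / INR s).
Proof.
  intros Hs Hg L0 L1 [Phi [l0 [l1 [HD [H0 [H1 ->]]]]]].
  assert (Hs0 : INR s <> 0) by (apply not_0_INR; lia).
  exists (fun x => / INR s * (Phi x + -1 * (g x / x ^ s))),
    (/ INR s * (l0 + -1 * 0)), (/ INR s * (l1 + -1 * 0)).
  split; [|split; [|split]].
  - intros x Hx.
    assert (Hxs : x ^ s <> 0) by (apply pow_nonzero; lra).
    evar_last.
    { apply (is_derive_scal (fun x => Phi x + -1 * (g x / x ^ s)) x (/ INR s)).
      apply (is_derive_plus Phi (fun x => -1 * (g x / x ^ s))).
      - apply HD, Hx.
      - apply (is_derive_scal (fun x => g x / x ^ s) x (-1)).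
        apply (is_derive_div g (fun x => x ^ s)); [apply Hg, Hx | | exact Hxs].
        apply (is_derive_pow (fun x => x) s x 1). exact (is_derive_id x). }
    unfold plus; simpl.
    destruct s as [|n]; [lia|]. rewrite Nat.pred_succ in *. rewrite <- !tech_pow_Rmult in *.
    field. repeat split; try lra; try assumption. apply pow_nonzero; lra.
  - apply filterlim_Rscal, filterlim_Rplus; [exact _ | exact H0|]. apply filterlim_Rscal, L0.
  - apply filterlim_Rscal, filterlim_Rplus; [exact _ | exact H1|]. apply filterlim_Rscal, L1.
  - field. exact Hs0.
Qed.

(** * The Dirichlet integral *)

(** The real part of the integral in [t] of [e^(i y z)], where [z = e^(i t)]
    runs through the quarter circle [0 <= t <= PI/2]. Its derivative in [y] is [- sin y / y]
    for [y > 0], it equals [PI/2] at [0] and it tends to [0] at infinity, so it is the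
    complementary sine integral and yields the Dirichlet integral. *)
Definition dirichlet_aux (y : R) : R :=
  RInt (fun t => exp (- y * sin t) * cos (y * cos t)) 0 (PI / 2).

Lemma dirichlet_aux_derive (y : R) :
  is_derive dirichlet_aux y
    (RInt (fun t => - exp (- y * sin t) * sin (t + y * cos t)) 0 (PI / 2)).
Proof.
  set (f := fun y t => exp (- y * sin t) * cos (y * cos t)).
  set (df := fun y t => - exp (- y * sin t) * sin (t + y * cos t)).
  assert (Hf : forall y t, is_derive (fun z => f z t) y (df y t)).
  { intros z t. unfold f, df. auto_derive; [trivial|]. rewrite sin_plus. ring. }
  assert (HD : forall y t, Derive (fun z => f z t) y = df y t).
  { intros z t. apply is_derive_unique, Hf. }
  rewrite <- (RInt_ext (fun t => Derive (fun z => f z t) y) _ 0 (PI / 2)).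
  2:{ intros t _. apply HD. }
  apply (is_derive_RInt_param f).
  - apply filter_forall. intros z t _. eexists. apply Hf.
  - intros t _.
    apply continuity_2d_pt_ext with (f := df). { intros; symmetry; apply HD. }
    unfold df.
    assert (Csin : forall x, continuity_pt sin x).
    { intros x. apply continuity_sin. }
    assert (Ccos : forall x, continuity_pt cos x).
    { intros x. apply continuity_cos. }
    assert (Cexp : forall x, continuity_pt exp x).
    { intros x. apply derivable_continuous_pt, derivable_pt_exp. }
    apply continuity_2d_pt_mult.
    + apply continuity_2d_pt_opp.
      apply (continuity_1d_2d_pt_comp exp (fun u v => - u * sin v)); [apply Cexp|].
      apply continuity_2d_pt_mult.
      * apply continuity_2d_pt_opp, continuity_2d_pt_id1.
      * apply (continuity_1d_2d_pt_comp sin (fun _ v => v)); [apply Csin | apply continuity_2d_pt_id2].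
    + apply (continuity_1d_2d_pt_comp sin (fun u v => v + u * cos v)); [apply Csin|].
      apply continuity_2d_pt_plus; [apply continuity_2d_pt_id2|].
      apply continuity_2d_pt_mult; [apply continuity_2d_pt_id1|].
      apply (continuity_1d_2d_pt_comp cos (fun _ v => v)); [apply Ccos | apply continuity_2d_pt_id2].
  - apply filter_forall. intros z. apply (ex_RInt_continuous (V := R_CompleteNormedModule)). intros t _.
    apply (ex_derive_continuous (V := R_NormedModule) (fun t => f z t)). unfold f. auto_derive. trivial.
Qed.

(** The integrand of the derivative is itself [1/y] times the [t]-derivative
    of [exp (- y sin t) sin (y cos t)], because [e^(i y e^(i t))] depends only on
    the product [y e^(i t)]; only the endpoints remain. *)
Lemma dirichlet_aux_derive_pos (y : R) :
  0 < y -> is_derive dirichlet_aux y (- (sin y / y)).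
Proof.
  intros Hy. evar_last; [apply dirichlet_aux_derive|].
  apply is_RInt_unique.
  set (g := fun t => exp (- y * sin t) * sin (y * cos t) / y).
  replace (- (sin y / y)) with (minus (g (PI / 2)) (g 0)).
  2:{ unfold g, minus, plus, opp; simpl.
      rewrite cos_PI2, cos_0, sin_0, !Rmult_0_r, sin_0, exp_0, Rmult_1_r. field. lra. }
  apply (is_RInt_derive (V := R_CompleteNormedModule) g).
  - intros t _. unfold g. auto_derive; [trivial|]. rewrite sin_plus. field. lra.
  - intros t _. apply (ex_derive_continuous (V := R_NormedModule)).
    auto_derive. trivial.
Qed.

Lemma dirichlet_aux_0 : dirichlet_aux 0 = PI / 2.
Proof.
  unfold dirichlet_aux.
  rewrite (RInt_ext _ (fun _ => 1)).
  - rewrite RInt_const. change ((PI / 2 - 0) * 1 = PI / 2). ring.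
  - intros t _. rewrite Ropp_0, !Rmult_0_l, exp_0, cos_0. apply Rmult_1_r.
Qed.

(** Any linear lower bound serves; [1/3] comes from [sin t >= t - t^3/6] and
    [t <= 2]. *)
Lemma sin_ge_third (t : R) : 0 <= t <= PI / 2 -> t / 3 <= sin t.
Proof.
  intros [H0 H1]. assert (H4 := PI_4).
  destruct (pre_sin_bound t 0 H0 ltac:(lra)) as [H _].
  eapply Rle_trans; [|exact H].
  unfold sin_approx, sin_term. simpl.
  replace (1 * (t * 1 / 1) + -1 * 1 * (t * (t * (t * 1)) / (1 + 1 + 1 + 1 + 1 + 1)))
    with (t - t * (t * t) / 6) by field.
  nra.
Qed.

(** The integrand is at most [exp (- y sin t)], hence at most
    [exp (- y t / 3)]. *)
Lemma dirichlet_aux_bound (y : R) : 0 < y -> Rabs (dirichlet_aux y) <= 3 / y.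
Proof.
  intros Hy. assert (HP := PI_RGT_0).
  set (h := fun t => - (3 / y) * exp (- y * (t / 3))).
  apply Rle_trans with (h (PI / 2) - h 0).
  - change (Rabs (dirichlet_aux y)) with (norm (dirichlet_aux y)).
    apply (norm_RInt_le (fun t => exp (- y * sin t) * cos (y * cos t))
      (fun t => exp (- y * (t / 3))) 0 (PI / 2)).
    + lra.
    + intros t Ht. change (Rabs (exp (- y * sin t) * cos (y * cos t)) <= exp (- y * (t / 3))).
      rewrite Rabs_mult, (Rabs_pos_eq (exp _)) by (left; apply exp_pos).
      rewrite <- (Rmult_1_r (exp (- y * (t / 3)))).
      apply Rmult_le_compat; [left; apply exp_pos | apply Rabs_pos | | ].
      * assert (Hs := sin_ge_third t Ht).
        assert (Hm : - y * sin t <= - y * (t / 3)) by nra.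
        destruct Hm as [Hm | ->]; [left; apply exp_increasing, Hm | right; reflexivity].
      * apply Rabs_le. generalize (COS_bound (y * cos t)); lra.
    + apply (RInt_correct (V := R_CompleteNormedModule)), (ex_RInt_continuous (V := R_CompleteNormedModule)). intros t _.
      apply (ex_derive_continuous (V := R_NormedModule)). auto_derive. trivial.
    + apply (is_RInt_derive h).
      * intros t _. unfold h. auto_derive; [trivial|].
        change (t * / 3) with (t / 3). field. lra.
      * intros t _. apply (ex_derive_continuous (V := R_NormedModule)). auto_derive. trivial.
  - unfold h. replace (- y * (0 / 3)) with 0 by field. rewrite exp_0.
    assert (He := exp_pos (- y * (PI / 2 / 3))).
    assert (0 < 3 / y) by (apply Rdiv_lt_0_compat; lra). nra.
Qed.

Lemma dirichlet_integral_pos (a : R) :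
  0 < a -> improper_value (fun x => sin (a * x) / x) (PI / 2).
Proof.
  intros Ha.
  exists (fun x => -1 * dirichlet_aux (a * x)), (-1 * (PI / 2)), (-1 * 0).
  split; [|split; [|split]]; [| | |ring].
  - intros x Hx.
    assert (Hax : 0 < a * x) by (apply Rmult_lt_0_compat; assumption).
    evar_last.
    { apply (is_derive_scal (fun x => dirichlet_aux (a * x)) x (-1)).
      apply (is_derive_comp dirichlet_aux (fun x => a * x)).
      - apply dirichlet_aux_derive_pos, Hax.
      - apply (is_derive_scal (fun x => x) x a). exact (is_derive_id x). }
    unfold scal; simpl; unfold mult; simpl. unfold one; simpl. field. lra.
  - apply filterlim_Rscal. rewrite <- dirichlet_aux_0.
    eapply filterlim_filter_le_1; [apply filter_le_within|].
    replace (dirichlet_aux 0) with (dirichlet_aux (a * 0)) by (f_equal; ring).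
    apply (ex_derive_continuous (fun x => dirichlet_aux (a * x))).
    apply (ex_derive_comp dirichlet_aux (fun x => a * x)).
    + eexists. apply dirichlet_aux_derive.
    + auto_derive. trivial.
  - apply filterlim_Rscal. apply filterlim_p_infty with (M := 3 / a).
    intros x Hx. rewrite Rminus_0_r.
    eapply Rle_trans; [apply dirichlet_aux_bound|].
    + apply Rmult_lt_0_compat; lra.
    + right. field. lra.
Qed.

(** The odd power absorbs the sign of [a] in the Dirichlet integral, and makes
    both sides vanish when [a = 0]. *)
Lemma dirichlet_integral_odd_power (a : R) (n : nat) :
  Nat.Odd n ->
  improper_value (fun x => a ^ n * (sin (a * x) / x)) (PI / 2 * Rabs a ^ n).
Proof.
  intros [s ->].
  destruct (Rtotal_order a 0) as [Ha | [-> | Ha]].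
  - replace (PI / 2 * Rabs a ^ (2 * s + 1))
      with (- a ^ (2 * s + 1) * (PI / 2)).
    2:{ rewrite (Rabs_left a Ha), !pow_add, !pow_mult. simpl.
        replace (- a * (- a * 1)) with (a * (a * 1)) by ring. ring. }
    apply improper_value_ext
      with (f := fun x => - a ^ (2 * s + 1) * (sin (- a * x) / x)).
    { intros x Hx. replace (- a * x) with (- (a * x)) by ring.
      rewrite sin_neg. field. lra. }
    apply improper_value_scal, dirichlet_integral_pos. lra.
  - rewrite Rabs_R0, pow_i, Rmult_0_r by lia.
    apply improper_value_ext with (2 := improper_value_0). intros; ring.
  - rewrite Rabs_pos_eq, Rmult_comm by lra.
    apply improper_value_scal, dirichlet_integral_pos, Ha.
Qed.

(** * Frullani integral of the cosine *)

Lemma Rabs_sin_le (x : R) : Rabs (sin x) <= Rabs x.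
Proof.
  assert (H : forall y, 0 <= y -> Rabs (sin y) <= y).
  { intros y Hy. destruct (MVT_gen sin 0 y cos) as [c [_ Hc]].
    - intros z _. auto_derive; [trivial | ring].
    - intros z _. apply continuity_sin.
    - rewrite sin_0, !Rminus_0_r in Hc. rewrite Hc, Rabs_mult, (Rabs_pos_eq y) by exact Hy.
      assert (Rabs (cos c) <= 1) by (apply Rabs_le; generalize (COS_bound c); lra).
      nra. }
  destruct (Rle_dec 0 x) as [Hx | Hx].
  - rewrite (Rabs_pos_eq x) by exact Hx. apply H, Hx.
  - rewrite <- Rabs_Ropp, <- sin_neg, (Rabs_left x) by lra. apply H. lra.
Qed.

Lemma one_minus_cos (x : R) : 1 - cos x = 2 * (sin (x / 2) * sin (x / 2)).
Proof.
  replace x with (2 * (x / 2)) at 1 by field. rewrite cos_2a_sin. ring.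
Qed.

(** The mean value theorem between [x] and [a x], points that both lie to the
    right of [min (1, a) x]. *)
Lemma dilation_increment_le (f f' : R -> R) (a x B : R) :
  0 < a -> 0 < x ->
  (forall y, Rmin 1 a * x <= y -> is_derive f y (f' y)) ->
  (forall y, Rmin 1 a * x <= y -> Rabs (f' y) <= B) ->
  Rabs (f (a * x) - f x) <= B * (Rabs (a - 1) * x).
Proof.
  intros Ha Hx Hd Hb.
  assert (Hm : forall y, Rmin x (a * x) <= y -> Rmin 1 a * x <= y).
  { intros y Hy. eapply Rle_trans; [|exact Hy].
    apply Rmin_glb; [generalize (Rmin_l 1 a) | generalize (Rmin_r 1 a)]; nra. }
  destruct (MVT_gen f x (a * x) f') as [c [[Hc _] E]].
  - intros y [Hy _]. apply Hd, Hm. lra.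
  - intros y [Hy _]. apply continuity_pt_filterlim.
    apply (ex_derive_continuous (V := R_NormedModule)). eexists. apply Hd, Hm, Hy.
  - rewrite E. replace (a * x - x) with ((a - 1) * x) by ring.
    rewrite !Rabs_mult, (Rabs_pos_eq x) by lra.
    apply Rmult_le_compat_r; [|apply Hb, Hm, Hc].
    apply Rmult_le_pos; [apply Rabs_pos | lra].
Qed.

(** The lower bound [1] is arbitrary: only increments are used. *)
Definition cosine_integral (y : R) : R := RInt (fun t => cos t / t) 1 y.

Lemma cosine_integral_derive (y : R) :
  0 < y -> is_derive cosine_integral y (cos y / y).
Proof.
  assert (Hc : forall t, 0 < t -> continuous (fun t => cos t / t) t).
  { intros t Ht. apply (ex_derive_continuous (V := R_NormedModule)).
    auto_derive. lra. }
  intros Hy. apply (is_derive_RInt (fun t => cos t / t) cosine_integral 1 y).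
  - generalize (open_gt 0 y Hy). apply filter_imp. intros z Hz.
    apply (RInt_correct (V := R_CompleteNormedModule)),
      (ex_RInt_continuous (V := R_CompleteNormedModule)).
    intros t [Ht _]. apply Hc. apply Rlt_le_trans with (2 := Ht).
    apply Rmin_pos; [lra | exact Hz].
  - apply Hc, Hy.
Qed.

(** The primitive [Ci (a x) - Ci x] is an increment of [Ci], which is [ln] up
    to a function of bounded derivative near [0], and [sin y / y] up to a
    function with derivative [sin y / y^2]. So the increment tends to [ln a]
    at [0] and to [0] at infinity. *)
Lemma frullani_cos_pos (a : R) :
  0 < a -> improper_value (fun x => (cos (a * x) - cos x) / x) (- ln a).
Proof.
  intros Ha. set (m := Rmin 1 a). assert (Hm : 0 < m) by (apply Rmin_pos; lra).
  exists (fun x => cosine_integral (a * x) - cosine_integral x), (ln a), 0.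
  split; [|split; [|split]]; [| | |ring].
  - intros x Hx.
    assert (Hax : 0 < a * x) by (apply Rmult_lt_0_compat; assumption).
    evar_last.
    { apply (is_derive_minus (fun x => cosine_integral (a * x)) cosine_integral).
      - apply (is_derive_comp cosine_integral (fun x => a * x)).
        + apply cosine_integral_derive, Hax.
        + apply (is_derive_scal (fun x => x) x a). exact (is_derive_id x).
      - apply cosine_integral_derive, Hx. }
    unfold minus, plus, opp, scal; simpl; unfold mult; simpl; unfold one; simpl.
    field. lra.
  - apply filterlim_at_right_0 with (M := 1 * Rabs (a - 1)). intros x [Hx _].
    rewrite Rmult_assoc.
    replace (cosine_integral (a * x) - cosine_integral x - ln a)
      with ((cosine_integral (a * x) - ln (a * x)) - (cosine_integral x - ln x))
      by (rewrite ln_mult by lra; ring).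
    assert (Hpos : forall y, m * x <= y -> 0 < y).
    { intros y Hy. apply Rlt_le_trans with (2 := Hy).
      apply Rmult_lt_0_compat; assumption. }
    apply (dilation_increment_le (fun y => cosine_integral y - ln y)
             (fun y => (cos y - 1) / y)); [exact Ha | exact Hx | |].
    + intros y Hy. apply Hpos in Hy.
      evar_last.
      { apply (is_derive_minus cosine_integral ln).
        - apply cosine_integral_derive, Hy.
        - apply is_derive_ln, Hy. }
      unfold minus, plus, opp; simpl. field. lra.
    + intros y Hy. apply Hpos in Hy.
      unfold Rdiv. rewrite Rabs_mult, Rabs_inv, (Rabs_pos_eq y) by lra.
      apply (Rle_div_l (Rabs (cos y - 1))); [lra|].
      rewrite Rmult_1_l, Rabs_minus_sym, one_minus_cos, !Rabs_mult, (Rabs_pos_eq 2) by lra.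
      assert (H1 := Rabs_sin_le (y / 2)). rewrite (Rabs_pos_eq (y / 2)) in H1 by lra.
      assert (H2 : Rabs (sin (y / 2)) <= 1)
        by (apply Rabs_le; generalize (SIN_bound (y / 2)); lra).
      assert (H3 := Rabs_pos (sin (y / 2))). nra.
  - apply filterlim_p_infty with (M := Rabs (a - 1) / (m * m) + / a + 1).
    intros x Hx1. assert (Hx : 0 < x) by lra. rewrite Rminus_0_r.
    assert (Hpos : forall y, m * x <= y -> 0 < y).
    { intros y Hy. apply Rlt_le_trans with (2 := Hy).
      apply Rmult_lt_0_compat; assumption. }
    assert (Hsin : forall y, 0 < y -> Rabs (sin y / y) <= / y).
    { intros y Hy. unfold Rdiv. rewrite Rabs_mult, Rabs_inv, (Rabs_pos_eq y) by lra.
      rewrite <- (Rmult_1_l (/ y)) at 2.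
      apply Rmult_le_compat_r; [left; apply Rinv_0_lt_compat, Hy|].
      apply Rabs_le; generalize (SIN_bound y); lra. }
    assert (Hinc := dilation_increment_le (fun y => cosine_integral y - sin y / y)
             (fun y => sin y / (y * y)) a x (/ (m * x * (m * x))) Ha Hx).
    lapply Hinc; [clear Hinc; intros Hinc; lapply Hinc; [clear Hinc; intros Hinc|]|].
    + replace (cosine_integral (a * x) - cosine_integral x) with
        ((cosine_integral (a * x) - sin (a * x) / (a * x)
          - (cosine_integral x - sin x / x)) + (sin (a * x) / (a * x) + - (sin x / x))) by ring.
      eapply Rle_trans; [apply Rabs_triang|].
      eapply Rle_trans; [apply Rplus_le_compat; [exact Hinc | apply Rabs_triang]|].
      rewrite Rabs_Ropp.
      assert (Hax : 0 < a * x) by (apply Rmult_lt_0_compat; assumption).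
      assert (H1 := Hsin _ Hax). assert (H2 := Hsin _ Hx).
      replace ((Rabs (a - 1) / (m * m) + / a + 1) / x) with
        (/ (m * x * (m * x)) * (Rabs (a - 1) * x) + (/ (a * x) + / x)) by (field; lra).
      lra.
    + intros y Hy. change (m * x <= y) in Hy.
      assert (H0 : 0 < m * x) by (apply Rmult_lt_0_compat; assumption).
      assert (Hy0 := Hpos y Hy).
      unfold Rdiv. rewrite Rabs_mult, Rabs_inv, (Rabs_pos_eq (y * y)) by nra.
      rewrite <- (Rmult_1_l (/ (m * x * (m * x)))).
      apply Rmult_le_compat; [apply Rabs_pos | left; apply Rinv_0_lt_compat; nra | | ].
      * apply Rabs_le; generalize (SIN_bound y); lra.
      * apply Rinv_le_contravar; nra.
    + intros y Hy. apply Hpos in Hy.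
      evar_last.
      { apply (is_derive_minus cosine_integral (fun y => sin y / y)).
        - apply cosine_integral_derive, Hy.
        - apply (is_derive_div sin (fun y => y)); [apply is_derive_sin | apply is_derive_id | lra]. }
      unfold minus, plus, opp, one; simpl. field. lra.
Qed.

(** The positive power kills the term [a = 0], for which the integral diverges;
    the value then holds because both sides are [0]. *)
Lemma frullani_cos_power (a : R) (n : nat) :
  (1 <= n)%nat ->
  improper_value (fun x => a ^ n * ((cos (a * x) - cos x) / x))
    (- (a ^ n * ln (Rabs a))).
Proof.
  intros Hn. replace (- (a ^ n * ln (Rabs a))) with (a ^ n * - ln (Rabs a)) by ring.
  destruct (Req_dec a 0) as [-> | Ha].
  - rewrite pow_i, Rmult_0_l by lia.
    apply improper_value_ext with (2 := improper_value_0). intros; ring.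
  - apply improper_value_scal.
    apply improper_value_ext with (f := fun x => (cos (Rabs a * x) - cos x) / x).
    + intros x _. unfold Rabs; destruct Rcase_abs; [|reflexivity].
      replace (- a * x) with (- (a * x)) by ring. rewrite cos_neg. reflexivity.
    + apply frullani_cos_pos, Rabs_pos_lt, Ha.
Qed.

(** * Families of successive derivatives *)

(** A function together with its successive derivatives given explicitly, in
    place of iterated [Derive]. *)
Definition derivative_family (D : nat -> R -> R) : Prop :=
  forall i x, is_derive (D i) x (D (S i) x).

Lemma derivative_family_Derive_n (D : nat -> R -> R) (i k : nat) (x : R) :
  derivative_family D -> Derive_n (D i) k x = D (i + k)%nat x.
Proof.
  intros HD; revert x; induction k as [|k IH]; intros x.
  - rewrite Nat.add_0_r. reflexivity.
  - simpl. rewrite (Derive_ext _ (D (i + k)%nat)) by exact IH.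
    rewrite Nat.add_succ_r. apply is_derive_unique, HD.
Qed.

Lemma derivative_family_taylor (D : nat -> R -> R) (i n : nat) (x : R) :
  derivative_family D -> 0 < x ->
  exists zeta, D i x =
    sum_f_R0 (fun m => x ^ m / INR (fact m) * D (i + m)%nat 0) n
    + x ^ S n / INR (fact (S n)) * D (i + S n)%nat zeta.
Proof.
  intros HD Hx. destruct (Taylor_Lagrange (D i) n 0 x Hx) as [zeta [_ E]].
  - intros t _ [|k] _; [exact I|].
    simpl. apply (ex_derive_ext (D (i + k)%nat)).
    + intros y. symmetry. apply derivative_family_Derive_n, HD.
    + eexists. apply HD.
  - exists zeta. rewrite E, Rminus_0_r, derivative_family_Derive_n by exact HD.
    f_equal. apply sum_eq. intros m _.
    rewrite derivative_family_Derive_n by exact HD. reflexivity.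
Qed.

Lemma sum_f_R0_last (f : nat -> R) (n : nat) :
  (forall m, (m < n)%nat -> f m = 0) -> sum_f_R0 f n = f n.
Proof.
  intros H. destruct n as [|n]; [reflexivity|].
  rewrite tech5, sum_eq_R0; [ring|]. intros m Hm. apply H. lia.
Qed.

Lemma inv_fact_bound (n : nat) : 0 < / INR (fact n) <= 1.
Proof.
  assert (H := INR_fact_lt_0 n). split; [apply Rinv_0_lt_compat, H|].
  rewrite <- Rinv_1. apply Rinv_le_contravar; [lra|].
  apply (le_INR 1). apply lt_O_fact.
Qed.

Lemma pow_le_pow_lt1 (x : R) (m n : nat) :
  0 < x < 1 -> (m <= n)%nat -> x ^ n <= x ^ m.
Proof.
  intros Hx H. replace n with (m + (n - m))%nat by lia. rewrite pow_add.
  assert (0 < x ^ m) by (apply pow_lt; lra).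
  assert (x ^ (n - m) <= 1) by (rewrite <- (pow1 (n - m)); apply pow_incr; lra).
  nra.
Qed.

(** If [i] is the first order with [D i 0 <> 0], Taylor's formula makes
    [D 0 x] equivalent to [D i 0 x^i / i!], which is not [O(x^n)] when
    [i < n]. Quantitatively, [|D i 0| <= C x] for all small [x]. *)
Lemma derivative_family_vanish (D : nat -> R -> R) (n : nat) (K : R) :
  derivative_family D ->
  (forall i, exists M, forall x, Rabs (D i x) <= M) ->
  (forall x, 0 < x -> Rabs (D 0%nat x) <= K * x ^ n) ->
  forall i, (i < n)%nat -> D i 0 = 0.
Proof.
  intros HD HB HK i. induction i as [i IH] using lt_wf_ind. intros Hi.
  destruct (HB (S i)) as [M HM].
  assert (HM0 : 0 <= M) by (eapply Rle_trans; [apply Rabs_pos | apply (HM 0)]).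
  assert (HF := INR_fact_lt_0 i).
  set (C := INR (fact i) * (Rabs K + M)).
  assert (HC : forall x, 0 < x < 1 -> Rabs (D i 0) <= C * x).
  { intros x Hx. destruct (derivative_family_taylor D 0 i x HD ltac:(lra)) as [zeta E].
    rewrite sum_f_R0_last in E.
    2:{ intros m Hm. simpl. rewrite IH by lia. ring. }
    rewrite !Nat.add_0_l in E.
    assert (Hxi : 0 < x ^ i) by (apply pow_lt; lra).
    assert (E' : D i 0 * x ^ i = INR (fact i) *
      (D 0%nat x + - (x ^ S i * / INR (fact (S i)) * D (S i) zeta))).
    { rewrite E. unfold Rdiv. field. split; apply INR_fact_neq_0. }
    apply Rmult_le_reg_r with (x ^ i); [exact Hxi|].
    rewrite <- (Rabs_pos_eq (x ^ i)) at 1 by lra.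
    rewrite <- Rabs_mult, E', Rabs_mult, (Rabs_pos_eq (INR (fact i))) by lra.
    unfold C. rewrite !Rmult_assoc. apply Rmult_le_compat_l; [lra|].
    eapply Rle_trans; [apply Rabs_triang|]. rewrite Rabs_Ropp, Rmult_plus_distr_r.
    change (x * x ^ i) with (x ^ S i).
    assert (Hx1 : 0 < x ^ S i) by (apply pow_lt; lra).
    apply Rplus_le_compat.
    - eapply Rle_trans; [apply HK; lra|].
      assert (x ^ n <= x ^ S i) by (apply pow_le_pow_lt1; [lra | lia]).
      assert (0 < x ^ n) by (apply pow_lt; lra).
      generalize (Rle_abs K) (Rabs_pos K). nra.
    - rewrite !Rabs_mult, (Rabs_pos_eq (x ^ S i)) by lra.
      destruct (inv_fact_bound (S i)) as [H1 H2].
      rewrite (Rabs_pos_eq (/ _)) by lra.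
      specialize (HM zeta). assert (H3 := Rabs_pos (D (S i) zeta)).
      rewrite (Rmult_comm M). apply Rmult_le_compat_l; [lra|]. nra. }
  assert (HC0 : 0 <= C).
  { unfold C. apply Rmult_le_pos; [lra|]. generalize (Rabs_pos K); lra. }
  destruct (Req_dec (D i 0) 0) as [|H0]; [assumption | exfalso].
  apply Rabs_pos_lt in H0. set (d := Rabs (D i 0)) in *.
  (* At this point [C x] is smaller than [d], against [HC]. *)
  assert (Hq : 0 < d / (d + C + 1) < 1).
  { split; [apply Rdiv_lt_0_compat; lra|]. apply Rlt_div_l; lra. }
  specialize (HC _ Hq).
  apply (Rmult_le_compat_r (d + C + 1)) in HC; [|lra].
  replace (C * (d / (d + C + 1)) * (d + C + 1)) with (C * d) in HC by (field; lra).
  nra.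
Qed.

(** In the Taylor formula of [D i] to order [n - i], all the derivatives at
    [0] vanish and only the remainder is left. *)
Lemma derivative_family_flat (D : nat -> R -> R) (n : nat) (M : R) :
  derivative_family D ->
  (forall x, Rabs (D n x) <= M) ->
  (forall i, (i < n)%nat -> D i 0 = 0) ->
  forall i x, (i < n)%nat -> 0 < x -> Rabs (D i x) <= M * x ^ (n - i).
Proof.
  intros HD HM HV i x Hi Hx.
  destruct (derivative_family_taylor D i (n - i - 1) x HD Hx) as [zeta E].
  rewrite sum_eq_R0 in E.
  2:{ intros m Hm. rewrite HV by lia. ring. }
  replace (S (n - i - 1)) with (n - i)%nat in E by lia.
  replace (i + (n - i))%nat with n in E by lia.
  rewrite E, Rplus_0_l. unfold Rdiv.
  assert (Hp : 0 < x ^ (n - i)) by (apply pow_lt; lra).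
  destruct (inv_fact_bound (n - i)) as [H1 H2].
  rewrite !Rabs_mult, (Rabs_pos_eq (x ^ _)), (Rabs_pos_eq (/ _)) by lra.
  specialize (HM zeta). assert (H3 := Rabs_pos (D n zeta)).
  rewrite (Rmult_comm M), Rmult_assoc. apply Rmult_le_compat_l; [lra|]. nra.
Qed.

(** Each integration by parts trades one power of [x] in the denominator for
    one derivative. The boundary term [D i x / x^(k+1)] is [O(x)] at [0], by
    flatness and [i + k + 1 < n], and [O(1/x)] at infinity, as [D i] is
    bounded. *)
Lemma improper_value_reduce (D : nat -> R -> R) (n : nat) (v : R) :
  derivative_family D ->
  (forall i, exists M, forall x, Rabs (D i x) <= M) ->
  (forall i, (i < n)%nat -> D i 0 = 0) ->
  forall k i, (i + k < n)%nat ->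
  improper_value (fun x => D (i + k)%nat x / x) v ->
  improper_value (fun x => D i x / x ^ S k) (v / INR (fact k)).
Proof.
  intros HD HB HV k; induction k as [|k IH]; intros i Hik Hv.
  - replace (v / INR (fact 0)) with v by (simpl; field).
    apply improper_value_ext with (2 := Hv).
    intros x _. rewrite Nat.add_0_r, pow_1. reflexivity.
  - rewrite <- Nat.add_succ_comm in Hv. apply IH in Hv; [|lia].
    replace (v / INR (fact (S k))) with (v / INR (fact k) / INR (S k)).
    2:{ change (fact (S k)) with (S k * fact k)%nat. rewrite mult_INR.
        field. split; [apply INR_fact_neq_0 | apply not_0_INR; lia]. }
    apply improper_value_by_parts with (g' := D (S i)).
    + lia.
    + intros x _. apply HD.
    + destruct (HB n) as [M HM]. apply filterlim_at_right_0 with (M := M).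
      intros x Hx. rewrite Rminus_0_r.
      assert (H0 : 0 < x ^ S k) by (apply pow_lt; lra).
      unfold Rdiv. rewrite Rabs_mult, Rabs_inv, (Rabs_pos_eq (x ^ S k)) by lra.
      apply (Rle_div_l (Rabs (D i x))); [exact H0|].
      eapply Rle_trans; [apply (derivative_family_flat D n M); auto; lia || lra|].
      rewrite Rmult_assoc. change (x * x ^ S k) with (x ^ S (S k)).
      apply Rmult_le_compat_l.
      * eapply Rle_trans; [apply Rabs_pos | apply (HM 0)].
      * apply pow_le_pow_lt1; [exact Hx | lia].
    + destruct (HB i) as [M HM]. apply filterlim_p_infty with (M := M).
      intros x Hx. rewrite Rminus_0_r.
      assert (H0 : x <= x ^ S k).
      { simpl. rewrite <- (Rmult_1_r x) at 1. apply Rmult_le_compat_l; [lra|].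
        apply pow_R1_Rle; lra. }
      unfold Rdiv. rewrite Rabs_mult, Rabs_inv, (Rabs_pos_eq (x ^ S k)) by lra.
      apply Rmult_le_compat; [apply Rabs_pos | left; apply Rinv_0_lt_compat; lra | apply HM |].
      apply Rinv_le_contravar; lra.
    + exact Hv.
Qed.

(** * Trigonometric sums *)

(** The [i]-th derivative of [sum c_t cos (a_t x)]: differentiating a cosine
    shifts its phase by [PI / 2]. *)
Definition trig_sum {T : Type} (c a : T -> R) (L : list T) (i : nat) (x : R) : R :=
  lsum (fun t => c t * a t ^ i * cos (a t * x + INR i * (PI / 2))) L.

Lemma trig_sum_derivative_family {T : Type} (c a : T -> R) (L : list T) :
  derivative_family (trig_sum c a L).
Proof.
  intros i x. unfold trig_sum. induction L as [|t L IH]; cbn [lsum fold_right].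
  - exact (is_derive_const 0 x).
  - apply (is_derive_plus (fun x => c t * a t ^ i * cos (a t * x + INR i * (PI / 2)))
      (fun x => lsum (fun t => c t * a t ^ i * cos (a t * x + INR i * (PI / 2))) L));
      [|exact IH].
    auto_derive; [trivial|]. rewrite S_INR.
    replace (a t * x + (INR i + 1) * (PI / 2))
      with (PI / 2 + (a t * x + INR i * (PI / 2))) by ring.
    rewrite (cos_plus (PI / 2)), cos_PI2, sin_PI2. simpl. unfold Rdiv. ring.
Qed.

Lemma trig_sum_bounded {T : Type} (c a : T -> R) (L : list T) (i : nat) :
  exists M, forall x, Rabs (trig_sum c a L i x) <= M.
Proof.
  exists (lsum (fun t => Rabs (c t * a t ^ i)) L). intros x.
  apply lsum_abs_le. intros t. rewrite Rabs_mult.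
  rewrite <- (Rmult_1_r (Rabs (c t * a t ^ i))) at 2.
  apply Rmult_le_compat_l; [apply Rabs_pos|].
  apply Rabs_le; generalize (COS_bound (a t * x + INR i * (PI / 2))); lra.
Qed.

Lemma cos_even_quarters (y : R) (s : nat) :
  cos (y + INR (2 * s) * (PI / 2)) = (-1) ^ s * cos y.
Proof.
  rewrite mult_INR. replace (y + INR 2 * INR s * (PI / 2)) with (y + INR s * PI)
    by (simpl; field).
  induction s as [|s IH].
  - simpl. rewrite Rmult_0_l, Rplus_0_r. ring.
  - rewrite S_INR. replace (y + (INR s + 1) * PI) with (y + INR s * PI + PI) by ring.
    rewrite neg_cos, IH. simpl. ring.
Qed.

Lemma cos_odd_quarters (y : R) (s : nat) :
  cos (y + INR (2 * s + 1) * (PI / 2)) = (-1) ^ S s * sin y.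
Proof.
  rewrite plus_INR. replace (y + (INR (2 * s) + INR 1) * (PI / 2))
    with (PI / 2 + y + INR (2 * s) * (PI / 2)) by (simpl; ring).
  rewrite cos_even_quarters, cos_plus, cos_PI2, sin_PI2. simpl. ring.
Qed.

Lemma improper_value_trig_sum_odd {T : Type} (c a : T -> R) (L : list T) (s : nat) :
  improper_value (fun x => trig_sum c a L (2 * s + 1) x / x)
    ((-1) ^ S s * (PI / 2) * lsum (fun t => c t * Rabs (a t) ^ (2 * s + 1)) L).
Proof.
  rewrite <- lsum_scal.
  apply improper_value_ext with (f := fun x => lsum (fun t =>
    (-1) ^ S s * c t * (a t ^ (2 * s + 1) * (sin (a t * x) / x))) L).
  - intros x Hx. unfold trig_sum, Rdiv. rewrite Rmult_comm, <- lsum_scal.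
    apply lsum_ext. intros t _. rewrite cos_odd_quarters. ring.
  - apply improper_value_lsum. intros t.
    replace ((-1) ^ S s * (PI / 2) * (c t * Rabs (a t) ^ (2 * s + 1)))
      with ((-1) ^ S s * c t * (PI / 2 * Rabs (a t) ^ (2 * s + 1))) by ring.
    apply improper_value_scal, dirichlet_integral_odd_power. exists s. reflexivity.
Qed.

(** The coefficients add up to [0], so [cos x] may be subtracted from every
    cosine and the sum split into convergent Frullani integrals. *)
Lemma improper_value_trig_sum_even {T : Type} (c a : T -> R) (L : list T) (s : nat) :
  (1 <= s)%nat ->
  lsum (fun t => c t * a t ^ (2 * s)) L = 0 ->
  improper_value (fun x => trig_sum c a L (2 * s) x / x)
    ((-1) ^ s * - lsum (fun t => c t * a t ^ (2 * s) * ln (Rabs (a t))) L).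
Proof.
  intros Hs H0.
  replace ((-1) ^ s * - lsum (fun t => c t * a t ^ (2 * s) * ln (Rabs (a t))) L)
    with (- (-1) ^ s * lsum (fun t => c t * a t ^ (2 * s) * ln (Rabs (a t))) L) by ring.
  rewrite <- lsum_scal.
  apply improper_value_ext with (f := fun x => lsum (fun t =>
    (-1) ^ s * c t * (a t ^ (2 * s) * ((cos (a t * x) - cos x) / x))) L).
  - intros x Hx.
    transitivity (trig_sum c a L (2 * s) x / x +
      - ((-1) ^ s * cos x / x) * lsum (fun t => c t * a t ^ (2 * s)) L).
    + unfold trig_sum, Rdiv. rewrite (Rmult_comm _ (/ x)), <- !lsum_scal.
      clear H0. induction L as [|t L IH]; [simpl; ring|].
      rewrite !lsum_cons, IH, cos_even_quarters. ring.
    + rewrite H0. ring.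
  - apply improper_value_lsum. intros t.
    replace (- (-1) ^ s * (c t * a t ^ (2 * s) * ln (Rabs (a t))))
      with ((-1) ^ s * c t * - (a t ^ (2 * s) * ln (Rabs (a t)))) by ring.
    apply improper_value_scal, frullani_cos_power. lia.
Qed.

(** * Integrals of powers of a difference of cosines *)

Lemma abel_summation (w L : nat -> R) (N : nat) :
  sum_n_m (fun n => sum_n_m w 1 n * (L (S n) - L n)) 1 (N - 1)
  = sum_n_m w 1 N * L N - sum_n_m (fun n => w n * L n) 1 N.
Proof.
  destruct N as [|N].
  - rewrite !sum_n_m_zero by (simpl; lia). unfold zero; simpl. ring.
  - rewrite Nat.sub_succ, Nat.sub_0_r. induction N as [|N IH].
    + rewrite (sum_n_m_zero _ 1 0) by lia. rewrite !sum_n_n. unfold zero; simpl. ring.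
    + rewrite (sum_n_Sm _ 1 N), IH by lia.
      rewrite (sum_n_Sm w 1 (S N)), (sum_n_Sm (fun n => w n * L n) 1 (S N)) by lia.
      unfold plus; simpl. ring.
Qed.

(** Both [1 - cos (alpha x)] and [1 - cos (beta x)] lie between [0] and a
    multiple of [x^2], by [1 - cos y = 2 sin^2 (y / 2)]. *)
Lemma cos_difference_bound (alpha beta x : R) :
  Rabs (cos (alpha * x) - cos (beta * x))
  <= (alpha * alpha + beta * beta) * (x * x).
Proof.
  assert (H : forall b, 0 <= 1 - cos (b * x) <= b * b * (x * x)).
  { intros b. rewrite one_minus_cos. assert (H := Rabs_sin_le (b * x / 2)).
    apply Rsqr_le_abs_1 in H. unfold Rsqr in H.
    generalize (Rle_0_sqr (sin (b * x / 2))) (Rle_0_sqr (b * x)). unfold Rsqr. lra. }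
  apply Rabs_le. generalize (H alpha) (H beta). lra.
Qed.

Theorem theorem4p3 (alpha beta : R) (hab : Rabs alpha <> Rabs beta)
    (p q : nat) (hp : (1 <= p)%nat) (hq : (2 <= q <= 2 * p)%nat)
    (N : nat) (r : nat -> nat * nat * nat)
    (hr : is_enumeration (Omega_tilde alpha beta p) N r) :
  (Nat.Even q ->
    is_I p q alpha beta
      (PI * (-1) ^ (q / 2) / (2 * INR (fact (q - 1)))
        * sum_n_m (fun n => Lambda p (r n)
                            * Rabs (chi alpha beta p (r n) 1) ^ (q - 1)) 1 N)) /\
  (Nat.Odd q ->
    is_I p q alpha beta
      ((-1) ^ ((q - 1) / 2) / INR (fact (q - 1))
        * sum_n_m (fun n => Xi alpha beta p q r n
                            * ln (Rabs (chi alpha beta p (r (S n)) 1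
                                        / chi alpha beta p (r n) 1))) 1 (N - 1))).
Proof.
  set (c := Lambda p). set (a := fun t => chi alpha beta p t 1).
  set (L := Omega_list p). set (D := trig_sum c a L).
  assert (HD : derivative_family D) by apply trig_sum_derivative_family.
  assert (HB : forall i, exists M, forall x, Rabs (D i x) <= M)
    by apply trig_sum_bounded.
  assert (HD0 : forall x, D 0%nat x = (cos (alpha * x) - cos (beta * x)) ^ p).
  { intros x. rewrite <- cos_difference_power by exact hp. apply lsum_ext.
    intros t _. unfold a, c. simpl INR. rewrite Rmult_0_l, Rplus_0_r, pow_O. ring. }
  assert (HV : forall i, (i < 2 * p)%nat -> D i 0 = 0).
  { apply derivative_family_vanish with (K := (alpha * alpha + beta * beta) ^ p);
      [exact HD | exact HB |].
    intros x Hx. rewrite HD0, <- RPow_abs, pow_mult, <- Rpow_mult_distr.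
    apply pow_incr. split; [apply Rabs_pos|].
    simpl (x ^ 2). rewrite Rmult_1_r. apply cos_difference_bound. }
  assert (Hmain : forall v, improper_value (fun x => D (q - 1)%nat x / x) v ->
    is_I p q alpha beta (v / INR (fact (q - 1)))).
  { intros v Hv. apply improper_value_is_RInt_gen.
    - apply improper_value_ext with (f := fun x => D 0%nat x / x ^ S (q - 1)).
      + intros x _. rewrite HD0. replace (S (q - 1)) with q by lia. reflexivity.
      + apply (improper_value_reduce D (2 * p)); auto. lia.
    - intros x Hx. apply (ex_derive_continuous (V := R_NormedModule)).
      auto_derive. apply pow_nonzero. lra. }
  assert (Hsum : forall f, (forall t, a t = 0 -> f t = 0) ->
    sum_n_m (fun n => f (r n)) 1 N = lsum f L).
  { intros f Hf. apply (lsum_enumeration alpha beta); assumption. }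
  split; intros [s Hs].
  - destruct s as [|s]; [lia|].
    change (sum_n_m _ 1 N)
      with (sum_n_m (fun n => c (r n) * Rabs (a (r n)) ^ (q - 1)) 1 N).
    rewrite (Hsum (fun t => c t * Rabs (a t) ^ (q - 1))).
    2:{ intros t ->. rewrite Rabs_R0, pow_i by lia. ring. }
    assert (Hv := improper_value_trig_sum_odd c a L s).
    replace (2 * s + 1)%nat with (q - 1)%nat in Hv by lia.
    apply Hmain in Hv. evar_last; [exact Hv|].
    replace (q / 2)%nat with (S s) by (rewrite Hs, Nat.mul_comm, Nat.div_mul; lia).
    field. apply INR_fact_neq_0.
  - assert (Hs' : (q - 1 = 2 * s)%nat) by lia.
    (* [D (q - 1)] vanishes at [0], as [q - 1 < 2 p]. *)
    assert (H0 : lsum (fun t => c t * a t ^ (2 * s)) L = 0).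
    { assert (H := HV (2 * s)%nat ltac:(lia)). unfold D, trig_sum in H.
      rewrite (lsum_ext _ (fun t => (-1) ^ s * (c t * a t ^ (2 * s)))) in H.
      - rewrite lsum_scal in H. apply Rmult_integral in H.
        destruct H as [H | H]; [|exact H].
        exfalso. revert H. apply pow_nonzero. lra.
      - intros t _. rewrite cos_even_quarters, Rmult_0_r, cos_0. ring. }
    assert (Hv := improper_value_trig_sum_even c a L s ltac:(lia) H0).
    rewrite <- Hs' in Hv, H0. apply Hmain in Hv. evar_last; [exact Hv|].
    rewrite (sum_n_m_ext_loc _ (fun n =>
      sum_n_m (fun j => c (r j) * a (r j) ^ (q - 1)) 1 n
      * (ln (Rabs (a (r (S n)))) - ln (Rabs (a (r n)))))).
    2:{ intros n Hn. destruct hr as [Hin _].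
        destruct (Hin n ltac:(lia)) as [_ H1].
        destruct (Hin (S n) ltac:(lia)) as [_ H2].
        change (a (r n) <> 0) in H1. change (a (r (S n)) <> 0) in H2.
        unfold Xi. fold c. f_equal. change (chi alpha beta p (r n) 1) with (a (r n)).
        change (chi alpha beta p (r (S n)) 1) with (a (r (S n))).
        unfold Rdiv. rewrite Rabs_mult, Rabs_inv.
        apply ln_div; apply Rabs_pos_lt; assumption. }
    rewrite (abel_summation (fun n => c (r n) * a (r n) ^ (q - 1))
                            (fun n => ln (Rabs (a (r n))))).
    rewrite (Hsum (fun t => c t * a t ^ (q - 1))).
    2:{ intros t ->. rewrite pow_i by lia. ring. }
    rewrite (Hsum (fun t => c t * a t ^ (q - 1) * ln (Rabs (a t)))).
    2:{ intros t ->. rewrite pow_i by lia. ring. }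
    (* The weights add up to [0], so the boundary term of the summation by
       parts drops out. *)
    rewrite H0.
    replace ((q - 1) / 2)%nat with s by (rewrite Hs', Nat.mul_comm, Nat.div_mul; lia).
    field. apply INR_fact_neq_0.
Qed.
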